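(* Let $n\ge 1$ and let $I$ and $J$ be two compositions of $n$. Then $$\sum_{\substack{\sigma\in\mathfrak{S}_n\\ \mathrm{Rec}(\sigma)=I\\ \mathrm{GC}^0(\sigma)=J}} q^{\mathrm{tot}(\sigma)}\;=\;\sum_{\substack{\sigma\in\mathfrak{S}_n\\ \mathrm{Rec}(\sigma)=I\\ \mathrm{GC}(\sigma)=J}} q^{\mathrm{tot}(\sigma)}.$$
   Context: A composition of $n$ is a sequence $I=(i_1,\dots,i_r)$ of positive integers with sum $n$; its descent set is $\{i_1,i_1+i_2,\dots,i_1+\cdots+i_{r-1}\}\subseteq\{1,\dots,n-1\}$, and a composition of $n$ is determined by its descent set. $\mathfrak{S}_n$ is the set of permutations $\sigma=\sigma_1\cdots\sigma_n$ of $\{1,\dots,n\}$. - A recoil of $\sigma$ is a value $i\in\{1,\dots,n-1\}$ such that $i+1$ is to the left of $i$ in $\sigma$; $\mathrm{Rec}(\sigma)$ is the composition of $n$ whose descent set is the set of recoils. - $\mathrm{GDes}(\sigma)=\{\sigma_i\mid 1\le i\le n-1,\ \sigma_i>\sigma_{i+1}\}$, and $\mathrm{GC}(\sigma)$ is the composition of $n$ whose descent set is $\{d-1\mid d\in\mathrm{GDes}(\sigma)\}$. - With the convention $\sigma_{n+1}=0$, $\mathrm{GDes}^0(\sigma)=\{\sigma_i\mid 1\le i\le n,\ \sigma_i>\sigma_{i+1}\}$ (it always contains $n$ and $\sigma_n$), and $\mathrm{GC}^0(\sigma)$ is the composition of $n$ whose descent set is $\mathrm{GDes}^0(\sigma)\setminus\{n\}$.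 - $\mathrm{tot}(\sigma)$ is the number of pairs $(i,j)$ with $i+1<j$ and $\sigma_{i+1}<\sigma_j<\sigma_i$. *)

(* Defs.v *)
From mathcomp Require Import all_boot all_fingroup.

Set Implicit Arguments.
Unset Strict Implicit.
Unset Printing Implicit Defensive.

Definition is_composition (n : nat) (I : seq nat) : bool :=
  all (fun i => 0 < i) I && (sumn I == n).

Definition descents (I : seq nat) : seq nat :=
  [seq sumn (take k I) | k <- iota 1 (size I).-1].

(* The composition of n whose descent set is D, for D a subset of
   {1, ..., n - 1}: the successive differences of 0 < d_1 < ... < d_k < n.
   Elements of D outside {1, ..., n - 1} are ignored. See comp_of_composition,
   comp_of_descents and descents_inj for n >= 1. *)
Definition comp_of (n : nat) (D : seq nat) : seq nat :=
  pairmap (fun a b => b - a) 0 (rcons [seq d <- iota 1 n.-1 | d \in D] n).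

(* Positions and values of permutations are numbered from 1: word s is
   s_1 ... s_n, and letter s i is s_i for 1 <= i <= n, and 0 otherwise; in
   particular letter s n.+1 = 0. *)
Definition word (n : nat) (s : 'S_n) : seq nat :=
  [seq (val (s i)).+1 | i <- enum 'I_n].

Definition letter (n : nat) (s : 'S_n) (i : nat) : nat := nth 0 (0 :: word s) i.

Definition recoils (n : nat) (s : 'S_n) : seq nat :=
  [seq i <- iota 1 n.-1 | index i.+1 (word s) < index i (word s)].

Definition Rec (n : nat) (s : 'S_n) : seq nat := comp_of n (recoils s).

Definition GDes (n : nat) (s : 'S_n) : seq nat :=
  [seq letter s i | i <- iota 1 n.-1 & letter s i.+1 < letter s i].

Definition GC (n : nat) (s : 'S_n) : seq nat :=
  comp_of n [seq d.-1 | d <- GDes s].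

Definition GDes0 (n : nat) (s : 'S_n) : seq nat :=
  [seq letter s i | i <- iota 1 n & letter s i.+1 < letter s i].

Definition GC0 (n : nat) (s : 'S_n) : seq nat :=
  comp_of n [seq d <- GDes0 s | d != n].

Definition tot (n : nat) (s : 'S_n) : nat :=
  #|[set p : 'I_n.+1 * 'I_n.+1 |
      [&& 0 < p.1, p.1.+1 < p.2 & letter s p.1.+1 < letter s p.2 < letter s p.1]]|.

Lemma letterE (n : nat) (s : 'S_n) (i : 'I_n) : letter s i.+1 = (s i).+1.
Proof.
by rewrite /letter /= (nth_map i) ?size_enum_ord // nth_ord_enum.
Qed.

Lemma letter_out (n : nat) (s : 'S_n) : letter s n.+1 = 0.
Proof. by rewrite /letter /= nth_default // size_map size_enum_ord. Qed.

Lemma pairmap_sub_pos (a : nat) (d : seq nat) :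
  path ltn a d -> all (fun i => 0 < i) (pairmap (fun a b => b - a) a d).
Proof.
by elim: d a => //= b d IH a /andP[ab /IH ->]; rewrite subn_gt0 ab.
Qed.

Lemma sumn_take_pairmap_sub (a : nat) (d : seq nat) (k : nat) :
  path ltn a d -> k <= size d ->
  a + sumn (take k (pairmap (fun a b => b - a) a d)) = nth 0 (a :: d) k.
Proof.
elim: d a k => [|b d IH] a [|k] //=; rewrite ?addn0 // => /andP[ab pd] kd.
by rewrite addnA subnKC 1?ltnW // IH.
Qed.

Lemma comp_of_path (n : nat) (D : seq nat) : 0 < n ->
  path ltn 0 (rcons [seq d <- iota 1 n.-1 | d \in D] n).
Proof.
move=> n0.
have -> : rcons [seq d <- iota 1 n.-1 | d \in D] n =
          [seq d <- iota 1 n | (d \in D) || (d == n)].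
  have -> : iota 1 n = rcons (iota 1 n.-1) n.
    by rewrite -{1}(prednK n0) -(addn1 n.-1) iotaD cats1 add1n prednK.
  rewrite filter_rcons eqxx orbT.
  congr rcons; apply: eq_in_filter => d.
  rewrite mem_iota add1n prednK // => /andP[_ dn].
  by rewrite (ltn_eqF dn) orbF.
rewrite path_min_sorted; first exact/sorted_filter/iota_ltn_sorted/ltn_trans.
by apply/allP => d; rewrite mem_filter mem_iota => /and3P[].
Qed.

Lemma comp_of_composition (n : nat) (D : seq nat) :
  0 < n -> is_composition n (comp_of n D).
Proof.
move=> n0; have pD := comp_of_path D n0.
rewrite /is_composition /comp_of (pairmap_sub_pos pD) /=.
have := sumn_take_pairmap_sub pD (leqnn _).
rewrite take_oversize ?size_pairmap // add0n => ->.
by rewrite nth_last /= last_rcons.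
Qed.

Lemma comp_of_descents (n : nat) (D : seq nat) : 0 < n ->
  descents (comp_of n D) =i [pred d | (0 < d < n) && (d \in D)].
Proof.
move=> n0 d; have pD := comp_of_path D n0.
suff -> : descents (comp_of n D) = [seq d <- iota 1 n.-1 | d \in D].
  by rewrite mem_filter mem_iota add1n prednK // andbC.
rewrite /descents /comp_of size_pairmap size_rcons /=.
apply: (@eq_from_nth _ 0); rewrite size_map size_iota // => k kD.
rewrite (nth_map 0) ?size_iota // nth_iota // add1n.
rewrite -[LHS]add0n sumn_take_pairmap_sub //; last by rewrite size_rcons ltnW.
by rewrite /= nth_rcons kD.
Qed.

Lemma descents_inj (n : nat) (I J : seq nat) :
  is_composition n I -> is_composition n J ->
  descents I =i descents J -> I = J.
Proof.
have srt (K : seq nat) m : is_composition m K ->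
    sorted ltn (descents K) /\ rcons (descents K) m =
    if K is [::] then [:: m] else scanl addn 0 K.
  have scanE (L : seq nat) a : scanl addn a L =
      [seq a + sumn (take k L) | k <- iota 1 (size L)].
    elim: L a => //= x L IH a; rewrite IH take0 /= addn0; congr (_ :: _).
    rewrite -[2]/(1 + 1) iotaDl -map_comp; apply: eq_map => k /=.
    by rewrite addnA.
  have pth (L : seq nat) a : all (fun i => 0 < i) L -> path ltn a (scanl addn a L).
    elim: L a => //= x L IH a /andP[x0 /IH ->].
    by rewrite -[X in X < _]addn0 ltn_add2l x0.
  case/andP=> Kp /eqP Km.
  have E : rcons (descents K) m = if K is [::] then [:: m] else scanl addn 0 K.
    case: K Kp Km => // x K Kp Km.
    rewrite scanE /descents /= -cats1 -[RHS]/(map _ (iota 1 (size K).+1)).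
    rewrite -(addn1 (size K)) iotaD map_cat /= !add0n take_size.
    by rewrite -Km.
  split=> //; have := pth K 0 Kp.
  case: K {Kp Km} E => // x K <-.
  by rewrite -cats1 cat_path => /andP[/path_sorted].
move=> cI cJ eqIJ; have [sI EI] := srt _ _ cI; have [sJ EJ] := srt _ _ cJ.
have {}eqIJ : descents I = descents J.
  exact: (irr_sorted_eq ltn_trans ltnn sI sJ eqIJ).
rewrite eqIJ {}EJ in EI.
case: I J cI cJ {sI sJ eqIJ} EI => [|x I] [|y J] //.
- by case/andP=> _ /eqP <- /andP[/andP[y0 _]]; rewrite /= addn_eq0 eqn0Ngt y0.
- case/andP=> /andP[x0 _] h /andP[_ /eqP e].
  by move: h; rewrite -e /= addn_eq0 eqn0Ngt x0.
move=> _ _ h.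
have K z : cancel (addn z) ((fun a b => b - a) z) by exact: addKn.
exact: (can_inj (scanlK K 0) (esym h)).
Qed.

(* Main.v *)
(* Build a permutation by inserting the values v = 1, 2, ..., n (a Laguerre
   history): at each step the letters <= v form blocks of consecutive positions.
   Record whether the left neighbour of v is smaller (l), whether its right
   neighbour is smaller (d), and the number g of descents straddling v to its
   left, which is the contribution of v to tot. The relative order of any two
   values, in particular the recoils, can be read off from the l's and g's and
   from the d's of letters that are not last.
   With the convention sigma_(n+1) = 0 the number k of available blocks evolves
   by k' = k + 1 - l - d from 1 to 0, with g < k at each step. With the
   convention sigma_(n+1) = infinity, replacing d_v by d_(v+1), with
   d_(n+1) := 1, leads to exactly the same constraints; this shift is the d - 1
   in the definition of GC. So both encodings are injections from S_n into one
   set of histories, which has n! elements, and they match the two sides. *)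
Require Import Defs.
From mathcomp Require Import all_boot all_order all_fingroup all_algebra.
From mathcomp Require Import zify.

Set Implicit Arguments.
Unset Strict Implicit.
Unset Printing Implicit Defensive.

Local Open Scope nat_scope.

(** * Histories and their enumeration *)

Definition step : Type := bool * bool * nat.

Definition steps (k : nat) : seq step :=
  [seq (x, g) | x <- [:: (false, false); (false, true); (true, false); (true, true)],
                g <- iota 0 k].

(** Step sequences of length [m] taking the counter from [k] to [0]. As [steps 0] is empty, the
    subtraction never truncates. *)
Fixpoint histories (m k : nat) : seq (seq step) :=
  if m is m'.+1 then
    [seq e :: h | e : step <- steps k, h : seq step <- histories m' (k.+1 - e.1.1 - e.1.2)]
  else if k is 0 then [:: [::]] else [::].

Lemma mem_steps k (e : step) : (e \in steps k) = (e.2 < k).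
Proof.
apply/allpairsPdep/idP => [[x [g [_ + ->]]]|gk]; first by rewrite mem_iota.
by exists e.1, e.2; split; [case: e.1 => [[] []] | rewrite mem_iota | case: e {gk}].
Qed.

(** The four pairs of flags send [k] to [k + 1], [k], [k] and [k - 1], each with [k] choices of [g];
    at [k = 0] the leading factor absorbs the truncated [k.-1]. *)
Lemma size_histories_rec m k :
  size (histories m.+1 k) =
  k * (size (histories m k.+1) + (size (histories m k)).*2 + size (histories m k.-1)).
Proof.
have sz (x : bool * bool) :
    sumn [seq size (histories m (k.+1 - e.1.1 - e.1.2))
         | e : step <- [seq (x, g) | g <- iota 0 k]] =
    k * size (histories m (k.+1 - x.1 - x.2)).
  rewrite -map_comp (@eq_map _ _ _ (fun=> size (histories m (k.+1 - x.1 - x.2)))) //.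
  by rewrite sumnE big_map big_const_seq count_predT size_iota iter_addn_0 mulnC.
rewrite /= size_allpairs_dep !map_cat !sumn_cat !sz /= !subn0 !subn1 /= -addnn; lia.
Qed.

(** The recurrence is solved by absorption, [j * C(m+1, j) = (m+1) * C(m, j)], and Pascal's rule. At
    [k = 1] the value is [(m+1)!]. *)
Lemma size_histories m k : size (histories m.+1 k) = m`! * (k * 'C(m.+1, k)).
Proof.
elim: m k => [|m IH] k.
  rewrite size_histories_rec /=.
  by case: k => [|[|[|k]]] //=; rewrite ?bin_small // !muln0.
rewrite size_histories_rec !IH; case: k => [|k]; first by rewrite !mul0n muln0.
have E j : j.+1 * 'C(m.+1, j.+1) = m.+1 * 'C(m, j) by rewrite -mul_bin_diag.
rewrite !E /= factS; case: k => [|k]; first by rewrite mul0n !bin0 !bin1; nia.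
by rewrite E !binS; nia.
Qed.

(** * Positions, letters and neighbours in a word *)

Definition pos n (s : 'S_n) v := index v (0 :: word s).

(* drops s v (pos s v) is the number of 31-2 patterns of s whose 2 is v. For
   u < v, drops s v (pos s u) locates u among the maximal factors of s with all
   letters < v; a factor starting at position 1 does not count. *)
Definition drops n (s : 'S_n) v j :=
  count (fun i => letter s i.+1 < v <= letter s i) (iota 0 j).

(** [letter] is [0] at positions [0] and [n.+1], so the first letter is always [lsmall] and the last
    always [rsmall]. *)
Definition lsmall n (s : 'S_n) v := letter s (pos s v).-1 < v.
Definition rsmall n (s : 'S_n) v := letter s (pos s v).+1 < v.

Section Words.
Context (n : nat).
Implicit Types s t : 'S_n.

Lemma size_word s : size (word s) = n.
Proof. by rewrite size_map size_enum_ord. Qed.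

Lemma mem_word s v : (v \in word s) = (0 < v <= n).
Proof.
apply/mapP/idP => [[i _ ->] /=|/andP[v0 vn]]; first exact: ltn_ord.
have vn' : v.-1 < n by rewrite prednK.
by exists (s^-1 (Ordinal vn'))%g; rewrite ?mem_enum // permKV /= prednK.
Qed.

Lemma uniq_word s : uniq (0 :: word s).
Proof.
rewrite /= mem_word /= map_inj_uniq ?enum_uniq // => i j [] /val_inj.
exact: perm_inj.
Qed.

Lemma word_inj : injective (@word n).
Proof.
move=> s t st; apply/permP => i; apply/val_inj/eqP.
by rewrite -eqSS -!letterE /letter st.
Qed.

Lemma letter_default s i : n < i -> letter s i = 0.
Proof. by move=> ni; rewrite /letter nth_default //= size_word. Qed.

Lemma letter_le s i : letter s i <= n.
Proof.
case: (leqP (size (0 :: word s)) i) => [|/(mem_nth 0)].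
  by move/(nth_default 0); rewrite /letter => ->.
by rewrite inE mem_word => /orP[/eqP|/andP[]]; rewrite /letter // => ->.
Qed.

Lemma letter_gt0 s i : 0 < i <= n -> 0 < letter s i.
Proof.
case: i => // i; rewrite /letter /= => ni.
have := mem_nth 0 (_ : i < size (word s)); rewrite size_word => /(_ ni).
by rewrite mem_word => /andP[].
Qed.

Lemma pos_bounds s v : 0 < v <= n -> 0 < pos s v <= n.
Proof.
move=> vn; have := vn; rewrite -(mem_word s) -index_mem size_word /pos /=.
by case: v vn.
Qed.

Lemma letter_pos s v : 0 < v <= n -> letter s (pos s v) = v.
Proof. by move=> vn; rewrite /letter nth_index // inE mem_word vn orbT. Qed.

Lemma pos_letter s i : i <= n -> pos s (letter s i) = i.
Proof. by move=> ni; rewrite /pos index_uniq ?uniq_word //= size_word. Qed.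

Lemma letter_eq s i v : 0 < v <= n -> (letter s i == v) = (i == pos s v).
Proof.
move=> vn; apply/eqP/eqP => [iv|->]; last exact: letter_pos.
case: (leqP i n) => ni; first by rewrite -iv pos_letter.
by have := letter_default s ni; rewrite iv; lia.
Qed.

(** * Drops across a moving threshold *)

Lemma drops_le s v i j : i <= j -> drops s v i <= drops s v j.
Proof. by move=> ij; rewrite -(subnKC ij) /drops iotaD count_cat leq_addr. Qed.

Lemma dropsS s v j :
  drops s v j.+1 = drops s v j + (letter s j.+1 < v <= letter s j).
Proof. by rewrite /drops -[in iota _ _](addn1 j) iotaD count_cat /= addn0. Qed.

Lemma drops_lt s v i j :
  i <= j -> v <= letter s i -> letter s j < v -> drops s v i < drops s v j.
Proof.
move=> ij vi; rewrite -(subnKC ij); elim: (j - i) => [|m IH] jv.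
  by rewrite addn0 in jv; lia.
rewrite addnS in jv *; rewrite dropsS jv /=.
case: (ltnP (letter s (i + m)) v) => [/IH|_]; first by rewrite addn0.
by rewrite addn1 ltnS drops_le ?leq_addr.
Qed.

Lemma drops1 s j : j <= n -> drops s 1 j = 0.
Proof.
elim: j => // j IH jn; rewrite dropsS (IH (ltnW jn)).
by have := @letter_gt0 s j.+1 jn; lia.
Qed.

Lemma drops_max s j : drops s n.+1 j = 0.
Proof. by elim: j => // j IH; rewrite dropsS IH; have := letter_le s j; lia. Qed.

(** Raising the threshold past [v] affects only the two adjacent pairs containing [v]: the pair
    ending in [v] becomes a drop unless [lsmall], and the pair starting with [v] stops being one if
    [rsmall]. *)
Lemma drops_step s v j : 0 < v <= n ->
  drops s v.+1 j + (pos s v < j) * rsmall s v + (pos s v <= j) * lsmall s v =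
  drops s v j + (pos s v <= j).
Proof.
move=> vn; have pv := pos_bounds s vn.
elim: j => [|j IH]; first by move: pv; rewrite /drops /=; case: (pos s v).
rewrite !dropsS.
have e1 := letter_eq s j.+1 vn; have e2 := letter_eq s j vn.
case: (ltngtP (pos s v) j.+1) => pj.
- case: (ltngtP (pos s v) j) pj IH e1 e2 => [||<-] //; rewrite /rsmall; lia.
- by lia.
- rewrite /lsmall pj /=; move: e1 e2 IH; rewrite pj; lia.
Qed.

(** If [v] stands left of [u], the word must drop across [v] between them, so the count at [u] is
    strictly larger; otherwise monotonicity applies. *)
Lemma pos_lt s u v : u < v -> 0 < u <= n -> 0 < v <= n ->
  (pos s u < pos s v) = (drops s v (pos s u) <= drops s v (pos s v)).
Proof.
move=> uv un vn; case: (leqP (pos s u) (pos s v)) => puv.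
  rewrite drops_le // ltn_neqAle puv andbT; apply/eqP => e.
  by move: uv; rewrite -(letter_pos s un) e letter_pos // ltnn.
by rewrite ltnNge (ltnW puv) /= leqNgt drops_lt ?letter_pos ?(ltnW puv).
Qed.

Lemma drops_next s v : 0 < v <= n ->
  drops s v.+1 (pos s v) + lsmall s v = drops s v (pos s v) + 1.
Proof.
by move=> vn; have := drops_step s (pos s v) vn; rewrite ltnn leqnn !mul1n addn0.
Qed.

(** This is [pos_lt] for [v] and [v.+1], with the count at [v] for threshold [v.+1] supplied by
    [drops_next]. *)
Lemma recoil_iff s v : 0 < v < n ->
  (pos s v.+1 < pos s v) =
  (drops s v.+1 (pos s v.+1) < drops s v (pos s v) + ~~ lsmall s v).
Proof.
move=> /andP[v0 vn]; have vn' : 0 < v <= n by lia.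
have vS : 0 < v.+1 <= n by lia.
have := pos_lt s (ltnSn v) vn' vS; have := drops_next s vn'.
have : pos s v != pos s v.+1.
  by apply/eqP => e; have := letter_pos s vn'; rewrite e letter_pos //; lia.
by lia.
Qed.

(** * Recovering a permutation from its history *)

Lemma word_eq_pos s t :
  (forall u v, u < v -> 0 < u <= n -> 0 < v <= n ->
     (pos s u < pos s v) = (pos t u < pos t v)) -> s = t.
Proof.
move=> st; apply: word_inj.
(* A word is the unique arrangement of its letters sorted by position. *)
have srt (r : 'S_n) : sorted (fun u v => pos r u < pos r v) (word r).
  apply/(sortedP 0) => i; rewrite size_word => iw.
  have := @pos_letter r i.+1; have := @pos_letter r i.+2; rewrite /letter /=.
  by move=> -> // ->; lia.
apply: (@irr_sorted_eq _ (fun u v => pos s u < pos s v)) => //.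
- by move=> v u w; apply: ltn_trans.
- by move=> v; apply: ltnn.
- rewrite (@eq_in_sorted _ (fun v => 0 < v <= n) _ (fun u v => pos t u < pos t v)) //.
    move=> u v; rewrite -!topredE /= => un vn.
    case: (ltngtP u v) => uv; [exact: st| |by rewrite uv !ltnn].
    have ne (r : 'S_n) : pos r u != pos r v.
      by apply/eqP => e; move: uv; rewrite -(letter_pos r un) e letter_pos // ltnn.
    by have := st _ _ uv vn un; have := ne s; have := ne t; lia.
  by apply/allP => v; rewrite mem_word.
- by move=> v; rewrite !mem_word.
Qed.

(** By induction on the threshold [w], the location of each [u < w] is determined, starting from
    [drops_next] at [u]; [pos_lt] then recovers the relative order. The induction consults [rsmall]
    at [w] only when [u] lies to the right of [w], so [w] is not last. *)
Lemma history_inj s t :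
  (forall v, 0 < v <= n ->
     [/\ lsmall s v = lsmall t v,
         drops s v (pos s v) = drops t v (pos t v) &
         pos s v < n -> pos t v < n -> rsmall s v = rsmall t v]) -> s = t.
Proof.
move=> h; apply: word_eq_pos => u v uv un vn.
have hd w : u < w <= n.+1 -> drops s w (pos s u) = drops t w (pos t u).
  elim: w => // w IH; rewrite ltnS => /andP[uw wn].
  have wn' : 0 < w <= n by lia.
  have [hl hg hr] := h w wn'.
  move: uw; rewrite leq_eqVlt => /orP[/eqP <-|uw].
    by have [e1 e2 _] := h u un; have := drops_next s un; have := drops_next t un; rewrite e1 e2; lia.
  have {}IH : drops s w (pos s u) = drops t w (pos t u) by apply: IH; lia.
  have e : (pos s w < pos s u) = (pos t w < pos t u).
    have ne (r : 'S_n) : pos r u != pos r w.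
      by apply/eqP => e; move: uw; rewrite -(letter_pos r un) e letter_pos // ltnn.
    by have := pos_lt s uw un wn'; have := pos_lt t uw un wn';
      have := ne s; have := ne t; lia.
  have pus := pos_bounds s un; have put := pos_bounds t un.
  have := drops_step s (pos s u) wn'; have := drops_step t (pos t u) wn'.
  have ne (r : 'S_n) : pos r u != pos r w.
    by apply/eqP => e'; move: uw; rewrite -(letter_pos r un) e' letter_pos // ltnn.
  have := ne s; have := ne t.
  case: (ltngtP (pos s w) (pos s u)) => // ps; case: (ltngtP (pos t w) (pos t u)) => // pt;
    lia.
have [_ hg _] := h v vn.
by rewrite !pos_lt // hg hd //; lia.
Qed.


(** * The two encodings and their injectivity *)

Definition history s (d : nat -> bool) : seq step :=
  [seq (lsmall s v, d v, drops s v (pos s v)) | v <- iota 1 n].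

(** The guard makes the last letter behave as if followed by infinity instead of the default [0]. *)
Definition desctop s v := (pos s v < n) && rsmall s v.

Definition history0 s := history s (rsmall s).
Definition history1 s := history s (fun v => (v == n) || desctop s v.+1).

Lemma history_nth s d v : 0 < v <= n ->
  nth (false, false, 0) (history s d) v.-1 = (lsmall s v, d v, drops s v (pos s v)).
Proof.
move=> vn; have vn' : v.-1 < n by lia.
by rewrite (nth_map 0) ?size_iota // nth_iota // add1n prednK //; lia.
Qed.

Lemma map_in_histories (l d : nat -> bool) (g k : nat -> nat) :
  (forall v, 0 < v <= n -> k v.+1 + d v + l v = k v + 1 /\ g v < k v) ->
  k n.+1 = 0 ->
  [seq (l v, d v, g v) | v <- iota 1 n] \in histories n (k 1).
Proof.
move=> hk k0; suff H m i :
    (forall v, i < v <= i + m -> k v.+1 + d v + l v = k v + 1 /\ g v < k v) ->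
    k (i + m).+1 = 0 ->
    [seq (l v, d v, g v) | v <- iota i.+1 m] \in histories m (k i.+1).
  exact: H.
elim: m i => [|m IH] i h; first by rewrite addn0 /= => ->.
rewrite addnS -addSn => {}k0.
have hi : i < i.+1 <= i + m.+1 by lia.
have [e gk] := h i.+1 hi.
apply/allpairsPdep; exists (l i.+1, d i.+1, g i.+1).
exists [seq (l v, d v, g v) | v <- iota i.+2 m]; split => //.
  by rewrite mem_steps.
have -> : (k i.+1).+1 - (l i.+1, d i.+1, g i.+1).1.1 - (l i.+1, d i.+1, g i.+1).1.2 = k i.+2.
  by rewrite /=; lia.
by apply: IH => // v hv; apply: h; lia.
Qed.

(** The counter is the number of maximal factors of letters [>= v], each ended by a drop, possibly
    to the final [0]. The factor containing [v] ends at or after [v], whence [g < k]. *)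
Lemma history0_in s : 0 < n -> history0 s \in histories n 1.
Proof.
move=> n0.
have -> : 1 = drops s 1 n.+1.
  by rewrite dropsS drops1 // letter_default //= letter_gt0 ?n0 /=.
apply: (map_in_histories (k := fun v => drops s v n.+1)); last exact: drops_max.
move=> v vn; have pv := pos_bounds s vn.
split.
  have := drops_step s n.+1 vn; have [-> ->] : pos s v < n.+1 /\ pos s v <= n.+1 by lia.
  by rewrite !mul1n.
by apply: drops_lt; rewrite ?letter_pos ?letter_default //; lia.
Qed.

Lemma history1_in s : 0 < n -> history1 s \in histories n 1.
Proof.
move=> n0.
have e1 : desctop s 1 = false.
  by rewrite /desctop /rsmall; case: ltnP => //= pn; have := @letter_gt0 s (pos s 1).+1; lia.
(* Step [v] carries the descent flag of [v.+1], so the counter has already absorbed the flag of [v];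
   the value [n.+1] is treated as a descent top, which brings the counter to [0]. *)
pose k v := drops s v n + ~~ ((v == n.+1) || desctop s v).
have -> : 1 = k 1 by rewrite /k drops1 // e1 orbF eqSS eq_sym -lt0n n0.
apply: (map_in_histories (k := k)); last by rewrite /k drops_max eqxx.
move=> v vn; have pv := pos_bounds s vn.
have vne : (v == n.+1) = false by lia.
rewrite /k eqSS vne /=; split.
  have := drops_step s n vn; have -> : pos s v <= n by lia.
  by rewrite /desctop mul1n mulnb; lia.
rewrite /desctop; case: (ltnP (pos s v) n) => pn /=; last first.
  have -> : pos s v = n by lia.
  by rewrite addn1.
have := drops_le s v pn; rewrite dropsS letter_pos // leqnn andbT -/(rsmall s v).
by lia.
Qed.

Lemma history_mapP s t d e : history s d = history t e ->
  forall v, 0 < v <= n ->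
  [/\ lsmall s v = lsmall t v, d v = e v & drops s v (pos s v) = drops t v (pos t v)].
Proof.
move=> h v vn; have := history_nth s d vn.
by rewrite h history_nth // => -[].
Qed.

Lemma history0_inj : injective history0.
Proof. by move=> s t /history_mapP h; apply: history_inj => v /h[]. Qed.

Lemma history1_inj : injective history1.
Proof.
move=> s t /history_mapP h; apply: history_inj => v vn; have [-> _ ->] := h v vn.
split=> // ps pt; have [v1|v1] := ltnP 1 v.
  have vn' : 0 < v.-1 <= n by lia.
  have [_ + _] := h _ vn'; have -> : (v.-1 == n) = false by lia.
  by rewrite /desctop prednK ?ps ?pt //; lia.
(* No step records the flag of [1], but a letter [1] that is not last has a larger right
   neighbour. *)
have hr (r : 'S_n) : pos r v < n -> rsmall r v = false.
  by move=> pn; rewrite /rsmall; have := @letter_gt0 r (pos r v).+1; lia.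
by rewrite !hr.
Qed.

(** * Reading the statistics off a history *)

Definition hist_rec (h : seq step) : seq nat :=
  let e := nth (false, false, 0) h in
  [seq v <- iota 1 n.-1 | (e v).2 < (e v.-1).2 + ~~ (e v.-1).1.1].

Definition hist_desc (h : seq step) : seq nat :=
  [seq v <- iota 1 n.-1 | (nth (false, false, 0) h v.-1).1.2].

Lemma eq_comp_of (D E : seq nat) :
  {in iota 1 n.-1, D =i E} -> comp_of n D = comp_of n E.
Proof. by move=> DE; rewrite /comp_of (eq_in_filter DE). Qed.

Lemma Rec_history s d : Rec s = comp_of n (hist_rec (history s d)).
Proof.
congr comp_of; apply: eq_in_filter => v; rewrite mem_iota => vn.
(* Steps are indexed from [0], so index [v] holds the step of [v.+1]. *)
rewrite -[X in nth _ _ X]/(v.+1.-1) !history_nth ?recoil_iff //=; try lia.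
rewrite -recoil_iff; last by lia.
by rewrite /pos /=; case: (v) vn.
Qed.

Lemma GC0_history s : GC0 s = comp_of n (hist_desc (history0 s)).
Proof.
apply: eq_comp_of => v vn; rewrite [in RHS]mem_filter vn andbT.
rewrite mem_iota in vn; rewrite history_nth /=; last by lia.
have vn' : 0 < v <= n by lia.
rewrite mem_filter /GDes0; have -> /= : v != n by lia.
apply/mapP/idP => [[i] | rv].
  rewrite mem_filter mem_iota => /andP[di iN] ->.
  by rewrite /rsmall pos_letter //; lia.
have pv := pos_bounds s vn'.
exists (pos s v); rewrite ?letter_pos //.
by rewrite mem_filter mem_iota letter_pos // -/(rsmall s v) rv; lia.
Qed.

Lemma GC_history s : GC s = comp_of n (hist_desc (history1 s)).
Proof.
apply: eq_comp_of => v vn; rewrite [in RHS]mem_filter vn andbT.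
rewrite mem_iota in vn; rewrite history_nth /=; last by lia.
have vn' : 0 < v.+1 <= n by lia.
have -> /= : (v == n) = false by lia.
apply/mapP/idP => [[d] | /andP[pn rv]].
  case/mapP => i; rewrite mem_filter mem_iota => /andP[di iN] -> ev.
  have -> : v.+1 = letter s i by lia.
  by rewrite /desctop /rsmall pos_letter ?di; lia.
have pv := pos_bounds s vn'.
exists v.+1 => //; apply/mapP; exists (pos s v.+1); rewrite ?letter_pos //.
by rewrite mem_filter mem_iota letter_pos // -/(rsmall s v.+1) rv; lia.
Qed.

(** The pairs counted by [tot] are grouped by the position of the middle letter. *)
Lemma tot_history s d : tot s = sumn [seq e.2 | e <- history s d].
Proof.
rewrite -map_comp sumnE big_map /=.
have -> : \sum_(v <- iota 1 n) drops s v (pos s v) =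
          \sum_(i < n) drops s (s i).+1 (pos s (s i).+1).
  have -> : iota 1 n = index_iota 1 n.+1 by rewrite /index_iota subn1.
  rewrite big_add1 big_mkord.
  by rewrite (reindex_inj (@perm_inj _ s)).
rewrite /tot cardsE -sum1_card big_mkcond /=.
rewrite -(pair_bigA _ (fun i j : 'I_n.+1 => nat_of_bool
  [&& 0 < i, i.+1 < j & letter s i.+1 < letter s j < letter s i])) exchange_big /=.
rewrite big_ord_recl big1 ?add0n; last by move=> i _; rewrite andbF.
apply: eq_bigr => j _; rewrite -letterE pos_letter //=.
rewrite /drops -sum1_count [RHS]big_mkcond.
have -> : iota 0 j.+1 = index_iota 0 j.+1 by rewrite /index_iota subn0.
rewrite -(big_mkord xpredT (fun i => nat_of_bool
  [&& 0 < i, i.+1 < j.+1 & letter s i.+1 < letter s j.+1 < letter s i])).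
rewrite [LHS](@big_cat_nat _ _ _ j.+1) //=; last by rewrite ltnS ltnW.
rewrite [X in _ + X]big_nat_cond [X in _ + X]big1 ?addn0; last by move=> i; lia.
(* A drop gives a pattern: [letter s i] differs from the middle letter, position [0] carries [0],
   and a pair ending at the middle letter is not a drop across it. *)
apply: eq_big_nat => i ij.
have ne : letter s i != letter s j.+1.
  by apply/eqP => /(congr1 (pos s)); rewrite !pos_letter //; have := ltn_ord j; lia.
have a0 : letter s 0 = 0 by [].
case: i ij ne => [|i] ij ne; first by case: ifP; rewrite a0; lia.
have [->|ij'] := eqVneq i.+1 j; first by case: ifP; lia.
have -> : i.+2 < j.+1 by lia.
by case: ifP; lia.
Qed.

End Words.

(** * Equidistribution through the common set of histories *)

Lemma perm_histories n : 0 < n ->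
  perm_eq [seq history0 s | s <- enum 'S_n] [seq history1 s | s <- enum 'S_n].
Proof.
move=> n0.
have im (f : 'S_n -> seq step) : injective f -> (forall s, f s \in histories n 1) ->
    uniq [seq f s | s <- enum 'S_n] /\ [seq f s | s <- enum 'S_n] =i histories n 1.
  move=> fI fH; have U : uniq [seq f s | s <- enum 'S_n] by rewrite map_inj_uniq ?enum_uniq.
  split=> //; have sub : {subset [seq f s | s <- enum 'S_n] <= histories n 1}.
    by move=> h /mapP[s _ ->].
  (* A duplicate-free list of [n!] elements inside a list of length [n!] exhausts it. *)
  case: (uniq_min_size U sub) => //.
  rewrite size_map -cardE card_Sn -(prednK n0) size_histories bin1 mul1n prednK //.
  by rewrite -{3}(prednK n0) factS prednK // mulnC.
have [U0 E0] := im _ (@history0_inj n) (fun s => history0_in s n0).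
have [U1 E1] := im _ (@history1_inj n) (fun s => history1_in s n0).
by apply: uniq_perm => // h; rewrite E0 E1.
Qed.

Local Open Scope ring_scope.

Theorem corollary6p4 (n : nat) (I J : seq nat) :
  (1 <= n)%N -> is_composition n I -> is_composition n J ->
  \sum_(s : 'S_n | (Rec s == I) && (GC0 s == J)) 'X^(tot s) =
  \sum_(s : 'S_n | (Rec s == I) && (GC s == J)) 'X^(tot s) :> {poly int}.
Proof.
move=> n0 _ _.
pose P h := (comp_of n (hist_rec n h) == I) && (comp_of n (hist_desc n h) == J).
pose F h : {poly int} := 'X^(sumn [seq e.2 | e : step <- h]).
(* Either side becomes a sum of the same function over a list of histories, which differs only by a
   permutation. *)
have E f (Q : pred 'S_n) : (forall s, Q s = P (f s)) ->
    (forall s, tot s = sumn [seq e.2 | e : step <- f s]) ->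
    \sum_(s : 'S_n | Q s) 'X^(tot s) = \sum_(h <- [seq f s | s <- enum 'S_n] | P h) F h.
  move=> QP tF; rewrite big_map big_enum_cond /=.
  by apply: eq_big => // s _; rewrite tF.
rewrite (E (@history0 n)); first last.
- by move=> s; apply: tot_history.
- by move=> s; rewrite /P -Rec_history -GC0_history.
rewrite (E (@history1 n)); first last.
- by move=> s; apply: tot_history.
- by move=> s; rewrite /P -Rec_history -GC_history.
exact/perm_big/perm_histories.
Qed.
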